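(* Let $0<b<\infty$, let $n\ge 1$ be an integer, and let $0=b_0<b_1<\cdots<b_n<b_{n+1}=b$. Let $g:[0,b]\to\mathbb{R}$ be continuous and increasing with $g(x)>0$ for $x\in(0,b]$, and let $f:[0,b]\to\mathbb{R}$ be such that $\phi(u)=f(g^{-1}(u))$ is a continuous function of $u\in[g(0),g(b)]$ which is alternately strictly convex and strictly concave on the $n+1$ intervals $[g(b_i),g(b_{i+1})]$, $i=0,\dots,n$, starting with strictly convex for $i=0$ (strictly convex for even $i$, strictly concave for odd $i$). (a) If $g(0)=0$ and $f(0)\le 0$, then $f/g$ is increasing on the first subinterval (up to $b_1$), and in each subsequent subinterval $(b_i,b_{i+1})$, $1\le i\le n$, $f/g$ changes monotonicity at most once; if it does, the change is from increasing to decreasing when $i$ is odd and from decreasing to increasing when $i$ is even. Moreover, $f/g$ changes monotonicity at most $n$ times in all. (b) If $g(0)=0$ and $f(0)>0$, or if $g(0)>0$, then $f/g$ changes monotonicity at most once in the first subinterval (up to $b_1$), its behavior in each subsequent subinterval $(b_i,b_{i+1})$, $1\le i\le n$, is as described in (a), and $f/g$ changes monotonicity at most $n+1$ times in all. The corresponding statement holds when $\phi$ is instead strictly concave for even $i$ and strictly convex for odd $i$: if $g(0)=0$ and $f(0)\ge0$, then $f/g$ is decreasing on the first subinterval, and in each $(b_i,b_{i+1})$, $1\le i\le n$, it changes monotonicity at most once, any such change being from decreasing to increasing for $i$ odd and from increasing to decreasing for $i$ even, with at most $n$ changes in all; if $g(0)=0$ and $f(0)<0$, or if $g(0)>0$,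 then there is at most one change of monotonicity in the first subinterval, the behavior in the subsequent subintervals is the same as just described, and there are at most $n+1$ changes in all.
   Context: ''Increasing'' and ''decreasing'' mean strictly increasing and strictly decreasing. The quotient $f/g$ is considered on the part of $[0,b]$ where $g\ne0$, i.e. on $[0,b]$ if $g(0)>0$ and on $(0,b]$ if $g(0)=0$. Since $g$ is continuous and strictly increasing, $g^{-1}:[g(0),g(b)]\to[0,b]$ is well defined. A function ''changes monotonicity (oscillates) exactly $m$ times'' on an interval $J$ if $J$ can be split by $m$ interior points into $m+1$ consecutive subintervals on which the function is alternately increasing and decreasing; ''at most $m$ times'' means exactly $k$ times for some $0\le k\le m$. A continuous function $\phi$ on an interval is strictly convex if $\phi(\lambda u_1+(1-\lambda)u_2)<\lambda\phi(u_1)+(1-\lambda)\phi(u_2)$ for all $u_1\neq u_2$ and $0<\lambda<1$; strictly concave means the reverse strict inequality. *)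

(* Defs.v *)
From HB Require Import structures.
From mathcomp Require Import all_boot all_order all_algebra.
From mathcomp Require Import all_classical all_reals all_analysis.

Set Implicit Arguments.
Unset Strict Implicit.
Unset Printing Implicit Defensive.

Import Order.TTheory GRing.Theory Num.Theory.
Import numFieldNormedType.Exports.

Local Open Scope classical_set_scope.
Local Open Scope ring_scope.

Section Defs.
Variable R : realType.
Implicit Types (J : set R) (h phi : R -> R) (c : nat -> R) (m k : nat).

Definition strictly_increasing_on J h : Prop :=
  {in J &, {homo h : x y / x < y}}.

Definition strictly_decreasing_on J h : Prop :=
  {in J &, {homo h : x y /~ x < y}}.

Definition strictly_convex_on J phi : Prop :=
  forall u1 u2 l : R, J u1 -> J u2 -> u1 != u2 -> 0 < l < 1 ->
  phi (l * u1 + (1 - l) * u2) < l * phi u1 + (1 - l) * phi u2.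

Definition strictly_concave_on J phi : Prop :=
  forall u1 u2 l : R, J u1 -> J u2 -> u1 != u2 -> 0 < l < 1 ->
  l * phi u1 + (1 - l) * phi u2 < phi (l * u1 + (1 - l) * u2).

(* The points c 0 < ... < c m.-1 cut J into m.+1 pieces, numbered 0, ..., m;
   piece k lies between c k.-1 and c k, except that the first one has no left
   cut and the last one no right cut. Cut points belong to both pieces. *)
Definition piece J c m k : set R :=
  [set x | [/\ J x, (0 < k)%N -> c k.-1 <= x & (k < m)%N -> x <= c k]].

(* up tells whether h is increasing (true) or decreasing (false) on the first
   piece. *)
Definition alternates (up : bool) m J h : Prop :=
  exists c, [/\ forall k, (k < m)%N -> J° (c k),
    forall k, (k.+1 < m)%N -> c k < c k.+1 &
    forall k, (k <= m)%N ->
      if up (+) odd k then strictly_increasing_on (piece J c m k) h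
      else strictly_decreasing_on (piece J c m k) h].

Definition changes_exactly m J h : Prop := exists up, alternates up m J h.

Definition changes_at_most m J h : Prop :=
  exists2 k, (k <= m)%N & changes_exactly k J h.

Definition changes_at_most_once_from (up : bool) J h : Prop :=
  changes_at_most 1 J h /\ (changes_exactly 1 J h -> alternates up 1 J h).

(* The values of the partial inverse outside of [g 0, g b] are irrelevant. *)
Definition inverse_on (b : R) (g : R -> R) : R -> R :=
  'pinv_(fun=> 0) `[0, b] g.

Definition quotient_domain (b : R) (g : R -> R) : set R :=
  [set x | x \in `[0, b] /\ g x != 0].

End Defs.

(* Main.v *)
Require Import Defs.
From HB Require Import structures.
From mathcomp Require Import all_boot all_order all_algebra.
From mathcomp Require Import all_classical all_reals all_analysis.
From mathcomp Require Import lra ring.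

Set Implicit Arguments.
Unset Strict Implicit.
Unset Printing Implicit Defensive.

Import Order.TTheory GRing.Theory Num.Theory.
Import numFieldNormedType.Exports.

Local Open Scope classical_set_scope.
Local Open Scope ring_scope.

(* In the variable u = g x the quotient is phi(u) / u. On a stretch where phi is
   strictly convex and u > 0 it is strictly quasi-convex: at an interior point it
   lies below the larger of the values at two surrounding points. Being
   continuous, it is a valley there (decreasing up to some point, possibly an
   endpoint, then increasing); on concave stretches it is a hill. Valleys and
   hills alternate, so the last direction on a stretch is the first direction on
   the next one, and each stretch adds at most one change. If phi(0) <= 0, the
   chord from the origin shows that the initial valley has no decreasing part. *)

(** * Monotonicity with the direction as a boolean *)

Definition lt_dir (R : realType) (up : bool) (x y : R) : Prop :=
  if up then x < y else y < x.

Lemma lt_dir_trans (R : realType) up (y x z : R) :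
  lt_dir up x y -> lt_dir up y z -> lt_dir up x z.
Proof.
case: up; rewrite /lt_dir => xy yz; first exact: lt_trans xy yz.
exact: lt_trans yz xy.
Qed.

Lemma lt_dirN (R : realType) up (x y : R) :
  lt_dir up (- x) (- y) -> lt_dir (~~ up) x y.
Proof. by case: up; rewrite /lt_dir ltrN2. Qed.

Lemma lt_dir_asym (R : realType) up (x y : R) :
  lt_dir up x y -> lt_dir (~~ up) x y -> False.
Proof.
by case: up; rewrite /lt_dir => xy yx; have := lt_trans xy yx; rewrite ltxx.
Qed.

Definition monotone_on (R : realType) (up : bool) (J : set R) (h : R -> R) :=
  if up then strictly_increasing_on J h else strictly_decreasing_on J h.

Lemma monotone_onP (R : realType) up (J : set R) (h : R -> R) :
  monotone_on up J h <->
  (forall x y, J x -> J y -> x < y -> lt_dir up (h x) (h y)).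
Proof.
split; case: up => /= mono x y.
- by move=> Jx Jy; apply: mono; exact: mem_set.
- by move=> Jx Jy; apply: mono; exact: mem_set.
- by rewrite !inE; exact: mono.
- by rewrite !inE => Jx Jy; exact: mono.
Qed.

Lemma sub_monotone_on (R : realType) up (J K : set R) (h : R -> R) :
  J `<=` K -> monotone_on up K h -> monotone_on up J h.
Proof.
move=> JK /monotone_onP mono; apply/monotone_onP => x y /JK Kx /JK Ky.
exact: mono.
Qed.

Lemma monotone_onN (R : realType) up (J : set R) (h : R -> R) :
  monotone_on up J (\- h) -> monotone_on (~~ up) J h.
Proof.
move=> /monotone_onP mono; apply/monotone_onP => x y Jx Jy xy.
exact/lt_dirN/mono.
Qed.

Lemma monotone_on_glue (R : realType) up (J : set R) (h : R -> R) t :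
  J t -> monotone_on up (J `&` [set x | x <= t]) h ->
  monotone_on up (J `&` [set x | t <= x]) h -> monotone_on up J h.
Proof.
move=> Jt /monotone_onP monol /monotone_onP monor.
apply/monotone_onP => x y Jx Jy xy.
have [yt|ty] := leP y t.
  by apply: monol => //; split => //=; apply: le_trans yt; exact: ltW.
have [tx|xt] := leP t x.
  by apply: monor => //; split => //=; exact: ltW.
apply: (@lt_dir_trans _ _ (h t)).
- by apply: monol => //; split => //=; exact: ltW.
- by apply: monor => //; split => //=; exact: ltW.
Qed.

Lemma monotone_on_false (R : realType) up (J : set R) (h : R -> R) x y :
  J x -> J y -> x < y -> monotone_on up J h -> monotone_on (~~ up) J h -> False.
Proof.
move=> Jx Jy xy /monotone_onP mono /monotone_onP mono'.
exact: lt_dir_asym (mono _ _ Jx Jy xy) (mono' _ _ Jx Jy xy).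
Qed.

(** * Building alternating functions from left to right *)

Lemma alternates0 (R : realType) up (J : set R) (h : R -> R) :
  monotone_on up J h -> alternates up 0 J h.
Proof.
move=> mono; exists (fun=> 0); split => // -[|//] _; rewrite addbF.
by apply: sub_monotone_on mono => x [].
Qed.

Lemma lt_cuts (R : realType) m (c : nat -> R) i j :
  (forall k, (k.+1 < m)%N -> c k < c k.+1) -> (i < j < m)%N -> c i < c j.
Proof.
move=> cinc /andP[]; elim: j => // j IHj; rewrite ltnS leq_eqVlt.
move=> /predU1P[->|ij] jm; first exact: cinc.
exact: lt_trans (IHj ij (ltnW jm)) (cinc _ jm).
Qed.

(** The cuts stay the same and only the last piece grows. Since no cut exceeds [t], the point [t]
    lies in that piece and the old and new parts can be glued there. *)
Lemma alternates_extend (R : realType) up m (J : set R) (h : R -> R) t s :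
  J t -> t <= s -> alternates up m (J `&` [set x | x <= t]) h ->
  monotone_on (up (+) odd m) (J `&` [set x | t <= x <= s]) h ->
  alternates up m (J `&` [set x | x <= s]) h.
Proof.
move=> Jt ts [c [cJ cinc cmono]] mono.
have Jts : J `&` [set x | x <= t] `<=` J `&` [set x | x <= s].
  by move=> x [Jx /= xt]; split => //=; exact: le_trans xt ts.
have ct k : (k < m)%N -> c k <= t by move=> /cJ /interior_subset [].
exists c; split => // [k /cJ|k]; first exact: interiorS.
rewrite leq_eqVlt => /predU1P[->{k}|km]; last first.
  apply: sub_monotone_on (cmono _ (ltnW km)) => x [[Jx _] xl xr].
  by split => //; split => //=; apply: le_trans (xr km) (ct _ km).
apply: (@monotone_on_glue _ _ _ _ t).
- split => //; last by rewrite ltnn.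
  by case: (m) ct => // k /(_ k (ltnSn _)).
- apply: sub_monotone_on (cmono _ (leqnn m)) => x [[[Jx _] xl _] xt].
  by split => //; rewrite ltnn.
- apply: sub_monotone_on mono => x [[[Jx /= xs] _ _] tx].
  by split => //=; apply/andP.
Qed.

(** Here [t] itself becomes the new last cut. The open interval []a, s[] around [t] is what makes
    this cut interior to the enlarged domain. *)
Lemma alternates_turn (R : realType) up m (J : set R) (h : R -> R) a t s :
  `]a, s[ `<=` J -> a < t < s -> alternates up m (J `&` [set x | x <= t]) h ->
  monotone_on (~~ (up (+) odd m)) (J `&` [set x | t <= x <= s]) h ->
  alternates up m.+1 (J `&` [set x | x <= s]) h.
Proof.
move=> asJ /andP[at_ ts] [c [cJ cinc cmono]] mono.
have Jts : J `&` [set x | x <= t] `<=` J `&` [set x | x <= s].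
  by move=> x [Jx /= xt]; split => //=; apply: le_trans xt (ltW ts).
have ct k : (k < m)%N -> c k < t.
  move=> /cJ ck.
  (* Old cuts are interior to a set bounded above by [t], hence strictly below [t]; this keeps the
     extended sequence of cuts strictly increasing. *)
  have : [set` Interval -oo%O (BRight t)]° (c k).
    by apply: interiorS ck => x [_ /= xt]; rewrite in_itv.
  by rewrite interior_itv /= in_itv.
exists (fun k => if (k < m)%N then c k else t); split => [k|k|k].
- rewrite ltnS leq_eqVlt => /predU1P[->|km]; last first.
    by rewrite km; apply: interiorS (cJ _ km).
  rewrite ltnn.
  have : `]a, s[%classic `<=` J `&` [set x | x <= s].
    move=> x xas; split; first exact: asJ.
    by move: xas; rewrite /= in_itv /= => /andP[_ /ltW].
  rewrite open_subsetE; last exact: itv_open.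
  by apply; rewrite /= in_itv /= at_ ts.
- by rewrite ltnS => km; rewrite km; case: ifP => [/cinc|_] //; exact: ct.
- rewrite leq_eqVlt => /predU1P[->|].
    rewrite /= addbN; apply: sub_monotone_on mono.
    move=> x [[Jx /= xs] /(_ erefl)]; rewrite ltnn => tx _.
    by split => //=; apply/andP.
  rewrite ltnS => km; apply: sub_monotone_on (cmono _ km).
  move=> x [[Jx /= xs] xl /(_ km) xr].
  (* Piece [k <= m] ends at [c k], or at [t] when [k = m]; in both cases it stays inside the old
     domain. *)
  have xt : x <= t.
    by move: xr; case: ifP => // kltm xr; apply: le_trans xr (ltW (ct _ _)).
  split => // [k0|kltm]; last by move: xr; rewrite kltm.
  by move: (xl k0); rewrite prednK// km.
Qed.

(* A last piece of direction opposite to [last] counts as one more change, so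
   that appending a piece of direction [last] costs nothing. *)
Definition alternates_ending (R : realType) (last : bool) m (J : set R) h :=
  exists up k, alternates up k J h /\
    (k + (up (+) odd k != last) <= m)%N.

(** If the function already ends in direction [last], its final piece is extended. Otherwise [t]
    becomes a cut, and the bound [m] has already paid for that change. *)
Lemma alternates_ending_append (R : realType) last m (J : set R) (h : R -> R)
    a t s :
  `]a, s[ `<=` J -> J t -> a < t <= s ->
  alternates_ending last m (J `&` [set x | x <= t]) h ->
  monotone_on last (J `&` [set x | t <= x <= s]) h ->
  alternates_ending last m (J `&` [set x | x <= s]) h.
Proof.
move=> asJ Jt /andP[at_]; rewrite le_eqVlt => /predU1P[<-//|ts].
move=> [up [k [alt km]]] mono.
have [d|d] := eqVneq (up (+) odd k) last.
  exists up, k; split => //.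
  by apply: alternates_extend alt _ => //; [exact: ltW | rewrite d].
have dN : ~~ (up (+) odd k) = last.
    by move: d; case: (up (+) _); case: (last).
exists up, k.+1; split.
  by apply: (alternates_turn asJ _ alt); rewrite ?at_ // dN.
by move: km; rewrite d /= addbN dN eqxx /= addn1 addn0.
Qed.

(** Only the surcharge for the final direction varies, and it grows by at most one. *)
Lemma alternates_ending_turn (R : realType) last m (J : set R) (h : R -> R) :
  alternates_ending last m J h -> alternates_ending (~~ last) m.+1 J h.
Proof.
move=> [up [k [alt km]]]; exists up, k; split => //.
by move: km; case: (_ (+) _); case: (last);
  rewrite /= ?addn0 ?addn1 // => /ltnW/leqW.
Qed.

Lemma alternates_ending_at_most (R : realType) last m (J : set R) (h : R -> R) :
  alternates_ending last m J h -> changes_at_most m J h.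
Proof.
move=> [up [k [alt km]]]; exists k; last by exists up.
exact: leq_trans (leq_addr _ _) km.
Qed.

(** There is one change if [c] is interior and none if it is an endpoint. An alternation starting
    the other way is impossible: wherever its cut lies relative to [c], some nondegenerate interval
    would carry both directions. *)
Lemma changes_at_most_once_from_open (R : realType) up (lo hi c : R) h :
  lo < hi -> lo <= c <= hi -> monotone_on up `[lo, c] h ->
  monotone_on (~~ up) `[c, hi] h ->
  changes_at_most_once_from up `]lo, hi[ h.
Proof.
move=> lohi /andP[loc chi] monol monor; split.
  suff [d [k [alt km]]] : alternates_ending (~~ up) 1 `]lo, hi[ h.
    exists k; last by exists d.
    exact: leq_trans (leq_addr _ _) km.
  move: loc; rewrite le_eqVlt => /predU1P[loc|loc].
    exists (~~ up), 0%N; split; last by rewrite addbF eqxx.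
    apply/alternates0/sub_monotone_on/monor => x /=.
    by rewrite loc !in_itv /= => /andP[/ltW -> /ltW ->].
  move: chi; rewrite le_eqVlt => /predU1P[chi|chi].
    exists up, 0%N; split; last by rewrite addbF; case: (up).
    apply/alternates0/sub_monotone_on/monol => x /=.
    by rewrite chi !in_itv /= => /andP[/ltW -> /ltW ->].
  exists up, 1%N; split; last by rewrite addbT eqxx.
  exists (fun=> c); split => // [k _|].
    by rewrite interior_itv /= in_itv /= loc chi.
  case=> [|[|//]] _ /=; rewrite ?addbF ?addbT.
    apply: sub_monotone_on monol => x [/=].
    by rewrite !in_itv /= => /andP[/ltW -> _] _ ->.
  apply: sub_monotone_on monor => x [/=].
  by rewrite !in_itv /= => /andP[_ /ltW ->] ->.
move=> [d alt].
have [<-//|dup] := eqVneq d up.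
have {dup} d_up : d = ~~ up by case: (d) (up) dup => -[].
move: alt; rewrite {d}d_up => -[c' [/(_ 0%N erefl) c'J _ mono]].
have := mono 1%N erefl; have := mono 0%N erefl.
rewrite /= addbF addbT negbK => monol' monor'.
have := interior_subset c'J; rewrite /= in_itv /= => /andP[loc' c'hi].
(* If [c <= c' 0], the conflict is just to the right of [c' 0]; otherwise it is just to the left.
   Midpoints keep the interval inside []lo, hi[], whose endpoints are excluded. *)
exfalso; have [cc'|cc'] := leP c (c' 0%N).
  have mid : c' 0%N < (c' 0%N + hi) / 2 < hi by apply/andP; split; lra.
  case/andP: mid => m1 m2.
  apply: (@monotone_on_false _ up `[c' 0%N, (c' 0%N + hi) / 2] h _ _ _ _ m1).
  - by rewrite /= in_itv /= lexx ltW.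
  - by rewrite /= in_itv /= lexx ltW.
  - apply: sub_monotone_on monor' => x /=; rewrite !in_itv /= => /andP[x1 x2].
    by split => //; rewrite /= in_itv /= (lt_le_trans loc' x1) (le_lt_trans x2 m2).
  - apply: sub_monotone_on monor => x /=; rewrite !in_itv /= => /andP[x1 x2].
    by rewrite (le_trans cc' x1) (le_trans x2 (ltW m2)).
have mid : lo < (lo + c' 0%N) / 2 < c' 0%N by apply/andP; split; lra.
case/andP: mid => m1 m2.
apply: (@monotone_on_false _ up `[(lo + c' 0%N) / 2, c' 0%N] h _ _ _ _ m2).
- by rewrite /= in_itv /= lexx ltW.
- by rewrite /= in_itv /= lexx ltW.
- apply: sub_monotone_on monol => x /=; rewrite !in_itv /= => /andP[x1 x2].
  by rewrite (le_trans (ltW m1) x1) (le_trans x2 (ltW cc')).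
- apply: sub_monotone_on monol' => x /=; rewrite !in_itv /= => /andP[x1 x2].
  by split => //; rewrite /= in_itv /= (lt_le_trans m1 x1) (le_lt_trans x2 c'hi).
Qed.

(** * Strictly quasi-convex functions are valleys *)

(** The turning point is the supremum of the points up to which [h] decreases. Beyond it some pair
    [u < v] has [h u <= h v], and quasi-convexity then forces strict increase from [v] on. Lower
    semicontinuity adds the point [c] itself to both sides. *)
Lemma valley (R : realType) (J : set R) (h : R -> R) lo hi :
  lo <= hi -> J `<=` `[lo, hi] -> is_interval J ->
  (forall x y z, J x -> J z -> x < y < z -> h y < Num.max (h x) (h z)) ->
  (forall x e, J x -> e < h x -> \forall y \near within J (nbhs x), e < h y) ->
  exists c, [/\ lo <= c <= hi, monotone_on false (J `&` [set x | x <= c]) h &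
    monotone_on true (J `&` [set x | c <= x]) h].
Proof.
move=> lohi Jlohi Jitv quasiconvex lsc.
(* [S] is not restricted to [J]: it contains [lo] vacuously, and its supremum may be a missing
   endpoint of [J], such as 0 when [g 0 = 0]. *)
pose S := [set x | lo <= x <= hi /\
  forall y z, J y -> J z -> y < z <= x -> h z < h y].
have Slo : S lo.
  split; first by rewrite lexx.
  move=> y z /Jlohi; rewrite /= in_itv /= => /andP[loy _] _ /andP[yz zlo].
  by have := lt_le_trans (le_lt_trans loy yz) zlo; rewrite ltxx.
have Sub : has_ubound S by exists hi => x [/andP[]].
pose c := sup S.
have loc : lo <= c by exact: ub_le_sup.
have chi : c <= hi by apply: ge_sup; [exists lo | move=> x [/andP[]]].
have decr y z : J y -> J z -> y < z < c -> h z < h y.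
  move=> Jy Jz /andP[yz zc].
  have [x [_ Sx] zx] : exists2 x, S x & z < x by apply: sup_gt => //; exists lo.
  by apply: Sx => //; rewrite yz ltW.
have incr y z : J y -> J z -> c < y < z -> h y < h z.
  move=> Jy Jz /andP[cy yz].
  (* A point beyond [sup S] is not in [S], so decrease already fails at or before [y]. *)
  have [u [v [Ju Jv /andP[uv vy] huv]]] :
      exists u v, [/\ J u, J v, u < v <= y & h u <= h v].
    apply: contrapT => nuv.
    have : S y; last by move=> /(ub_le_sup Sub); rewrite leNgt cy.
    split.
      rewrite (le_trans loc (ltW cy)) /=.
      by move: (Jlohi _ Jy); rewrite /= in_itv => /andP[].
    move=> u v Ju Jv uvy; rewrite ltNge; apply/negP => huv.
    by apply: nuv; exists u, v.
  have above w x : J x -> v < w < x -> h v < h w -> h w < h x.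
    move=> Jx /andP[vw wx] hvw.
    have := quasiconvex v w x Jv Jx; rewrite vw wx => /(_ isT).
    by rewrite lt_max => /orP[/(lt_trans hvw)|//]; rewrite ltxx.
  have hv w : J w -> v < w -> h v < h w.
    move=> Jw vw; have := quasiconvex u v w Ju Jw; rewrite uv vw => /(_ isT).
    by rewrite lt_max ltNge huv.
  move: vy; rewrite le_eqVlt => /predU1P[vy|vy].
    by rewrite -vy; apply: hv => //; rewrite vy.
  by apply: above => //; [rewrite vy | exact: hv].
exists c; split; first by rewrite loc.
- apply/monotone_onP => y z [Jy _] [Jz /= zc] yz.
  move: zc; rewrite le_eqVlt => /predU1P[zc|zc]; last by apply: decr; rewrite ?yz.
  (* The endpoint [z = c]: if [h y <= h c], then [h m < h c] at the midpoint [m], so by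
     semicontinuity [h m < h w] for [w] near [c]. But [h] decreases from [m] to [w]. *)
  rewrite {}zc in Jz yz *.
  pose m := (y + c) / 2.
  have [ym mc] : y < m /\ m < c by rewrite /m; split; lra.
  have J_in w : y < w < c -> J w.
    by move=> /andP[yw wc]; apply: (Jitv y c) => //; rewrite !ltW.
  have hmy : h m < h y by apply: decr => //; [apply: J_in|]; apply/andP.
  rewrite /lt_dir ltNge; apply/negP => /(lt_le_trans hmy) /(lsc _ _ Jz).
  rewrite near_withinE => /nbhs_ballP[d /= d0 near_c].
  (* The maximum puts [w] both to the right of [m] and within [d] of [c]. *)
  pose w := Num.max ((m + c) / 2) (c - d / 2).
  have [mw wc] : m < w /\ w < c
    by rewrite /w lt_max gt_max; split; [apply/orP; left|apply/andP; split]; lra.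
  have Jw : J w by apply: J_in; rewrite (lt_trans ym mw).
  have : h m < h w.
    apply: near_c => //; rewrite /ball /= gtr0_norm ?subr_gt0//.
    have : c - d / 2 <= w by rewrite /w le_max lexx orbT.
    lra.
  by apply/negP; rewrite -leNgt ltW//; apply: decr => //; [apply: J_in|]; apply/andP.
- apply/monotone_onP => y z [Jy /= cy] [Jz _] yz.
  move: cy; rewrite le_eqVlt => /predU1P[cy|cy]; last by apply: incr; rewrite ?cy.
  (* The endpoint [y = c] is the mirror image. *)
  rewrite -{}cy in Jy yz *.
  pose m := (c + z) / 2.
  have [cm mz] : c < m /\ m < z by rewrite /m; split; lra.
  have J_in w : c < w < z -> J w.
    by move=> /andP[cw wz]; apply: (Jitv c z) => //; rewrite !ltW.
  have hmz : h m < h z by apply: incr => //; [apply: J_in|]; apply/andP.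
  rewrite /lt_dir ltNge; apply/negP => /(lt_le_trans hmz) /(lsc _ _ Jy).
  rewrite near_withinE => /nbhs_ballP[d /= d0 near_c].
  pose w := Num.min ((c + m) / 2) (c + d / 2).
  have [cw wm] : c < w /\ w < m
    by rewrite /w gt_min lt_min; split; [apply/andP; split|apply/orP; left]; lra.
  have Jw : J w by apply: J_in; rewrite cw (lt_trans wm mz).
  have : h m < h w.
    apply: near_c => //; rewrite /ball /= distrC gtr0_norm ?subr_gt0//.
    have : w <= c + d / 2 by rewrite /w ge_min lexx orbT.
    lra.
  by apply/negP; rewrite -leNgt ltW//; apply: incr => //; [apply: J_in|]; apply/andP.
Qed.

(** * Strict convexity and the ratio phi(u) / u *)

Definition convex_dir (R : realType) (concave : bool) (J : set R) phi :=
  if concave then strictly_concave_on J phi else strictly_convex_on J phi.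

Lemma strictly_concave_onN (R : realType) (J : set R) (phi : R -> R) :
  strictly_concave_on J phi -> strictly_convex_on J (\- phi).
Proof.
move=> conc u v l Ju Jv uv l01; have := conc u v l Ju Jv uv l01.
by rewrite /= !mulrN -opprD ltrN2.
Qed.

(** This is convexity with weight [(w - v) / (w - u)], cleared of its denominator so that the later
    estimates are polynomial. *)
Lemma strictly_convex_chord (R : realType) (a c u v w : R) phi :
  strictly_convex_on `[a, c] phi -> a <= u -> u < v < w -> w <= c ->
  phi v * (w - u) < (w - v) * phi u + (v - u) * phi w.
Proof.
move=> conv au /andP[uv vw] wc.
have wu0 : 0 < w - u by lra.
have wu_neq0 : w - u != 0 by rewrite gt_eqF.
have l01 : 0 < (w - v) / (w - u) < 1.
  apply/andP; split; first by rewrite divr_gt0//; lra.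
  by rewrite ltr_pdivrMr// mul1r; lra.
have u_in : `[a, c]%classic u by rewrite /= in_itv /= au; lra.
have w_in : `[a, c]%classic w by rewrite /= in_itv /= wc andbT; lra.
have uw : u != w by rewrite lt_eqF//; lra.
have := conv u w _ u_in w_in uw l01.
have -> : (w - v) / (w - u) * u + (1 - (w - v) / (w - u)) * w = v by field.
rewrite -(ltr_pM2r wu0); congr (_ < _).
by field.
Qed.

(** Let [r = phi v / v]. If [r] were at least both outer ratios, [phi] would lie on or below the
    line of slope [r] through the origin at [u] and [w], and on it at [v]. Strict convexity puts
    [phi v] strictly below the chord, a contradiction. *)
Lemma strictly_convex_ratio_lt_max (R : realType) (a c u v w : R) phi :
  strictly_convex_on `[a, c] phi -> 0 < u -> a <= u -> u < v < w -> w <= c ->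
  phi v / v < Num.max (phi u / u) (phi w / w).
Proof.
move=> conv u0 au uvw wc; have := strictly_convex_chord conv au uvw wc.
case/andP: uvw => uv vw; rewrite lt_max => chord.
have v0 : 0 < v by lra.
have w0 : 0 < w by lra.
apply/negP => /negP; rewrite negb_or -!leNgt.
rewrite ler_pdivrMr // ler_pdivrMr // => /andP[].
have : phi v / v * v = phi v by rewrite divfK// gt_eqF.
move: (phi v / v) => r rv ru rw.
have : (w - v) * phi u <= (w - v) * (r * u) by rewrite ler_pM2l//; lra.
have : (v - u) * phi w <= (v - u) * (r * w) by rewrite ler_pM2l//; lra.
move: chord; rewrite -rv; nra.
Qed.

(** The chord starting at 0 has a nonpositive value there, so dropping the term in [phi 0] only
    weakens the bound on [phi v]. *)
Lemma strictly_convex_ratio_lt (R : realType) (c v w : R) phi :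
  strictly_convex_on `[0, c] phi -> phi 0 <= 0 -> 0 < v < w -> w <= c ->
  phi v / v < phi w / w.
Proof.
move=> conv phi0 vw wc; have := strictly_convex_chord conv (lexx 0) vw wc.
case/andP: vw => v0 vw; rewrite !subr0 => chord.
rewrite ltr_pdivrMr // mulrAC ltr_pdivlMr; last by lra.
have : (w - v) * phi 0 <= 0 by rewrite pmulr_rle0//; lra.
lra.
Qed.


(** * The quotient f / g on its domain *)

(** Continuity of [f] comes from the factorization [f = phi \o g]. As [phi] is continuous only
    relative to [[g 0, g b]], the range of [g] enters as a hypothesis. *)
Lemma cvg_ratio_within (R : realType) (b : R) (f g phi : R -> R) (x : R) :
  {within `[0, b], continuous g} ->
  {within `[g 0, g b], continuous phi} ->
  (forall y : R, 0 <= y <= b -> g 0 <= g y <= g b) ->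
  (forall y : R, 0 <= y <= b -> phi (g y) = f y) ->
  0 <= x <= b -> g x != 0 ->
  f y / g y @[y --> within `[0, b] (nbhs x)] --> f x / g x.
Proof.
move=> /subspace_continuousP gcont /subspace_continuousP phicont grange phig.
move=> xb gx0.
have xI : `[0, b]%classic x by rewrite /= in_itv.
have g_cvg := gcont x xI.
have gxI : `[g 0, g b]%classic (g x) by rewrite /= in_itv /=; exact: grange.
have near_in : \forall y \near within `[0, b] (nbhs x), 0 <= y <= b.
  by rewrite near_withinE; near=> y; rewrite /= in_itv.
apply: cvgM; last exact: cvgV.
rewrite -(phig x xb).
have : phi (g y) @[y --> within `[0, b] (nbhs x)] --> phi (g x).
  apply: (cvg_comp g phi _ (phicont _ gxI)) => P /g_cvg near_P.
  have {}near_P : \forall y \near within `[0, b] (nbhs x),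
    `[g 0, g b]%classic (g y) -> P (g y) by exact: near_P.
  change (\forall y \near within `[0, b] (nbhs x), P (g y)).
  apply: filterS2 near_P near_in => y gP /grange gy.
  by apply: gP; rewrite /= in_itv.
apply: cvg_trans; apply: near_eq_cvg.
by near=> y; rewrite phig//; near: y.
Unshelve. all: by end_near.
Qed.

Section QuotientTurns.
Variables (R : realType) (b : R) (g : R -> R).
Hypotheses (g_cont : {within `[0, b], continuous g})
  (g_incr : strictly_increasing_on `[0, b] g)
  (g_pos : forall x, x \in `]0, b] -> 0 < g x) (g0_ge0 : 0 <= g 0).

Let D := quotient_domain b g.

Lemma denominator_lt x y : 0 <= x -> x < y -> y <= b -> g x < g y.
Proof.
move=> x0 xy yb; apply: g_incr => //; rewrite inE /= in_itv /=.
- by rewrite x0 (le_trans (ltW xy)).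
- by rewrite yb andbT (le_trans x0 (ltW xy)).
Qed.

Lemma denominator_le x y : 0 <= x -> x <= y -> y <= b -> g x <= g y.
Proof.
move=> x0; rewrite le_eqVlt => /predU1P[->//|xy yb].
by apply/ltW/denominator_lt.
Qed.

Lemma quotient_domainP x : D x <-> 0 <= x <= b /\ 0 < g x.
Proof.
rewrite /D /quotient_domain /= in_itv /=; split => -[/[dup] xb /andP[x0 x_b] gx].
  by split => //; rewrite lt_neqAle eq_sym gx (le_trans g0_ge0)// denominator_le.
by split => //; rewrite gt_eqF.
Qed.

Lemma sub_quotient_domain s : s <= b -> `]0, s[ `<=` D.
Proof.
move=> sb x /=; rewrite in_itv /= => /andP[x0 xs]; apply/quotient_domainP.
have xb : x <= b by exact: le_trans (ltW xs) sb.
by split; [rewrite (ltW x0) | apply: g_pos; rewrite in_itv /= x0].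
Qed.

(** The increasing substitution [u = g x] carries quasi-convexity of phi(u) / u over to [f / g]. The
    point [c] need not lie in [D]: it may be 0 while [g 0 = 0]. *)
Lemma quotient_valley f phi lo hi :
  {within `[g 0, g b], continuous phi} ->
  (forall y : R, 0 <= y <= b -> phi (g y) = f y) ->
  0 <= lo -> lo <= hi -> hi <= b -> strictly_convex_on `[g lo, g hi] phi ->
  exists c, [/\ lo <= c <= hi,
    monotone_on false (D `&` [set x | lo <= x <= c]) (fun x => f x / g x) &
    monotone_on true (D `&` [set x | c <= x <= hi]) (fun x => f x / g x)].
Proof.
move=> phi_cont phig lo0 lohi hib conv.
pose J := D `&` [set x | lo <= x <= hi].
have [|x|x y|x y z|x e|c [cb decr incr]] := @valley R J (fun x => f x / g x) lo hi.
- by [].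
- by case=> _; rewrite /= in_itv.
- move=> [/quotient_domainP[/andP[x0 xb] gx] /andP[lox xhi]].
  move=> [/quotient_domainP[/andP[y0 yb] gy] /andP[loy yhi]].
  move=> z /andP[xz zy]; split; last by rewrite /= (le_trans lox) ?(le_trans zy).
  have zb : z <= b by exact: le_trans zy yb.
  apply/quotient_domainP; split; first by rewrite zb andbT (le_trans x0).
  by apply: lt_le_trans gx _; exact: denominator_le.
- move=> [/quotient_domainP[/andP[x0 xb] gx] /andP[lox xhi]].
  move=> [/quotient_domainP[/andP[z0 zb] gz] /andP[loz zhi]].
  move=> /andP[xy yz].
  rewrite -!phig; first apply: (strictly_convex_ratio_lt_max conv) => //.
  + exact: denominator_le.
  + by rewrite !denominator_lt// ?(le_trans (ltW yz)) ?(le_trans x0 (ltW xy)).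
  + exact: denominator_le.
  + by rewrite z0.
  + by rewrite x0.
  + by rewrite (le_trans x0 (ltW xy)) (le_trans (ltW yz)).
- move=> [/quotient_domainP[xb gx] _] ex.
  have grange (y : R) : 0 <= y <= b -> g 0 <= g y <= g b.
    by move=> /andP[y0 yb]; rewrite !denominator_le // (le_trans y0).
  have /cvgr_gt /(_ _ ex) : f y / g y @[y --> within `[0, b] (nbhs x)] --> f x / g x.
    by apply: (cvg_ratio_within g_cont phi_cont) => //; rewrite gt_eqF.
  rewrite !near_withinE; apply: filterS => y ey [/quotient_domainP[yb _] _].
  by apply: ey; rewrite /= in_itv.
- exists c; split => //.
  + apply: sub_monotone_on decr => x [Dx /= /andP[lox xc]].
    by split => //; split => //=; case/andP: cb => _; rewrite lox; exact: le_trans.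
  + apply: sub_monotone_on incr => x [Dx /= /andP[cx xhi]].
    by split => //; split => //=; case/andP: cb => loc _; rewrite xhi (le_trans loc).
Qed.

(** The concave case is the convex one for [- f] and [- phi]. *)
Lemma quotient_turns s f phi lo hi :
  {within `[g 0, g b], continuous phi} ->
  (forall y : R, 0 <= y <= b -> phi (g y) = f y) ->
  0 <= lo -> lo <= hi -> hi <= b -> convex_dir s `[g lo, g hi] phi ->
  exists c, [/\ lo <= c <= hi,
    monotone_on s (D `&` [set x | lo <= x <= c]) (fun x => f x / g x) &
    monotone_on (~~ s) (D `&` [set x | c <= x <= hi]) (fun x => f x / g x)].
Proof.
case: s => phi_cont phig lo0 lohi hib; last exact: quotient_valley.
move=> /strictly_concave_onN convN.
have [|y yb|c [cb decr incr]] := @quotient_valley (\- f) (\- phi) lo hi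
  _ _ lo0 lohi hib convN.
- by move=> x; apply: continuousN; exact: phi_cont.
- by rewrite /= phig.
have qN : (fun x => (\- f) x / g x) = \- (fun x => f x / g x).
  by apply/funext => x /=; rewrite mulNr.
rewrite qN in decr incr.
by exists c; split => //; [exact: monotone_onN decr | exact: monotone_onN incr].
Qed.

Lemma quotient_monotone_near0 s f phi hi :
  (forall y : R, 0 <= y <= b -> phi (g y) = f y) ->
  0 <= hi -> hi <= b -> convex_dir s `[g 0, g hi] phi ->
  g 0 = 0 -> (if s then 0 <= f 0 else f 0 <= 0) ->
  monotone_on (~~ s) (D `&` [set x | x <= hi]) (fun x => f x / g x).
Proof.
move=> phig hi0 hib conv g0 f0.
have f0E : f 0 = phi 0 by rewrite -[in RHS]g0 phig // lexx (le_trans hi0).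
rewrite {}f0E in f0; rewrite g0 in conv.
apply/monotone_onP => x y [/quotient_domainP[xb gx] /= xhi].
move=> [/quotient_domainP[yb gy] /= yhi] xy.
have gxy : 0 < g x < g y.
  by rewrite gx denominator_lt//; [case/andP: xb | case/andP: yb].
have ghi : g y <= g hi by apply: denominator_le => //; case/andP: yb.
rewrite -!phig //; case: s conv f0 => /= conv f0; last first.
  exact: strictly_convex_ratio_lt conv f0 gxy ghi.
have /= := strictly_convex_ratio_lt (strictly_concave_onN conv) _ gxy ghi.
by rewrite oppr_le0 !mulNr ltrN2 => /(_ f0).
Qed.

(** * Counting changes over the stretches; [s] tells whether the first one is concave *)

Section Pieces.
Variables (s : bool) (n : nat) (bs : nat -> R) (f phi : R -> R).
Hypotheses (bs0 : bs 0%N = 0) (bsn : bs n.+1 = b)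
  (bs_lt : forall i, (i <= n)%N -> bs i < bs i.+1)
  (phi_cont : {within `[g 0, g b], continuous phi})
  (phig : forall y : R, 0 <= y <= b -> phi (g y) = f y)
  (phi_dir : forall i, (i <= n)%N ->
    convex_dir (odd i (+) s) `[g (bs i), g (bs i.+1)] phi).

Let q := fun x => f x / g x.
Let D1 := D `&` [set x | x <= bs 1%N].

Lemma breakpoint_bounds i : (i <= n.+1)%N -> 0 <= bs i <= b.
Proof.
move=> i_n; rewrite -bs0 -bsn.
have mono j k : (j <= k <= n.+1)%N -> bs j <= bs k.
  rewrite leq_eqVlt => /andP[/predU1P[->//|jk] kn].
  by apply/ltW/(@lt_cuts _ n.+2) => //; rewrite ?jk.
by rewrite !mono ?i_n /=.
Qed.

Lemma piece_turns i : (i <= n)%N ->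
  exists c, [/\ bs i <= c <= bs i.+1,
    monotone_on (odd i (+) s) (D `&` [set x | bs i <= x <= c]) q &
    monotone_on (~~ (odd i (+) s)) (D `&` [set x | c <= x <= bs i.+1]) q].
Proof.
move=> i_n; have /andP[i0 _] := breakpoint_bounds (leqW i_n).
have /andP[_ i1b] : 0 <= bs i.+1 <= b by exact: breakpoint_bounds.
apply: (quotient_turns phi_cont phig) => //; last exact: phi_dir.
exact: ltW (bs_lt i_n).
Qed.

(** For [i >= 1] the whole closed stretch lies in [D], since [bs i > 0]. Hence both monotone parts
    include their endpoints. *)
Lemma changes_in_piece i : (1 <= i <= n)%N ->
  changes_at_most_once_from (odd i (+) s) `]bs i, bs i.+1[ q.
Proof.
move=> /andP[i0 i_n]; have [c [cb mono mono']] := piece_turns i_n.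
have /andP[_ i1b] : 0 <= bs i.+1 <= b by exact: breakpoint_bounds.
have bsi0 : 0 < bs i.
  by rewrite -bs0; apply: (@lt_cuts _ n.+2) => //; rewrite i0 leqW.
have inD x : bs i <= x <= bs i.+1 -> D x.
  move=> /andP[ix xi]; apply/quotient_domainP.
  have x0 : 0 < x by exact: lt_le_trans ix.
  have xb : x <= b by exact: le_trans xi i1b.
  by rewrite (ltW x0) xb; split => //; apply: g_pos; rewrite in_itv /= x0.
case/andP: (cb) => ic ci.
apply: (changes_at_most_once_from_open (bs_lt i_n) cb).
- apply: sub_monotone_on mono => x; rewrite /= in_itv /= => /andP[ix xc].
  by split; [apply: inD; rewrite ix (le_trans xc) | rewrite /= ix].
- apply: sub_monotone_on mono' => x; rewrite /= in_itv /= => /andP[cx xi].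
  by split; [apply: inD; rewrite xi (le_trans ic) | rewrite /= cx].
Qed.

(** A turning point at 0 leaves a single monotone piece, and is treated apart because 0 may be
    outside [D]. A positive turning point costs the one change allowed. *)
Lemma changes_first_piece : alternates_ending (~~ s) 1 D1 q.
Proof.
have [c [/andP[]]] := piece_turns (leq0n n).
have /andP[_ b1b] : 0 <= bs 1 <= b by exact: breakpoint_bounds.
rewrite bs0 /= le_eqVlt => /predU1P[<- _ _ mono|c0 cb1 mono mono'].
  exists (~~ s), 0%N; split; last by rewrite addbF eqxx.
  apply/alternates0/sub_monotone_on/mono => x [Dx /= xb1].
  by split => //=; case/quotient_domainP: Dx => /andP[-> _].
apply: (@alternates_ending_append _ _ _ _ _ 0 c).
- exact: sub_quotient_domain.
- apply/quotient_domainP; have cb : c <= b by exact: le_trans b1b.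
  by rewrite (ltW c0) cb; split => //; apply: g_pos; rewrite in_itv /= c0.
- by rewrite c0.
- apply: alternates_ending_turn; exists s, 0%N; split; last by rewrite addbF eqxx.
  apply/alternates0/sub_monotone_on/mono => x [Dx /= xc].
  by split => //=; case/quotient_domainP: Dx => /andP[-> _].
- exact: mono'.
Qed.

(** Here [m] bounds the changes on the first stretch. By induction, stretch [i] ends in direction
    [~~ (odd i (+) s)], which is the direction in which stretch [i.+1] starts. So crossing a
    breakpoint is free and each further stretch costs one. *)
Lemma changes_total m :
  alternates_ending (~~ s) m D1 q -> changes_at_most (m + n) D q.
Proof.
move=> first_piece.
have DE : D = D `&` [set x | x <= bs n.+1].
  apply/seteqP; split => [x Dx|x []//]; split => //=.
  by rewrite bsn; case/quotient_domainP: Dx => /andP[].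
have inD x : 0 < x -> x <= b -> D x.
  move=> x0 xb; apply/quotient_domainP; rewrite (ltW x0) xb; split => //.
  by apply: g_pos; rewrite in_itv /= x0.
suff /(_ _ (leqnn n)) : forall i, (i <= n)%N ->
    alternates_ending (~~ (odd i (+) s)) (m + i) (D `&` [set x | x <= bs i.+1]) q.
  by rewrite -DE => /alternates_ending_at_most.
elim=> [_|i IHi i_n]; first by rewrite addn0.
have [c [/andP[ic ci] mono mono']] := piece_turns i_n.
have i2b : bs i.+2 <= b by case/andP: (@breakpoint_bounds i.+2 i_n).
have i1_gt0 : 0 < bs i.+1.
  by rewrite -bs0; apply: (@lt_cuts _ n.+2) => //=; rewrite !ltnS ltnW.
have c0 : 0 < c by exact: lt_le_trans ic.
have cb : c <= b by exact: le_trans ci i2b.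
(* The stretch is peeled off from the right: its part after [c], then the paid turn at [c], then its
   part before [c], which continues the previous direction. *)
apply: (@alternates_ending_append _ _ _ _ _ 0 c) => //.
- exact: sub_quotient_domain.
- exact: inD.
- by rewrite c0.
rewrite addnS; apply: alternates_ending_turn.
apply: (@alternates_ending_append _ _ _ _ _ 0 (bs i.+1)) => //.
- exact: sub_quotient_domain.
- by apply: inD => //; exact: le_trans ic cb.
- by rewrite i1_gt0.
by rewrite /= addNb; apply: IHi; exact: ltnW.
Qed.

Lemma changes_from_zero :
  g 0 = 0 -> (if s then 0 <= f 0 else f 0 <= 0) ->
  [/\ monotone_on (~~ s) D1 q,
    forall i, (1 <= i <= n)%N ->
      changes_at_most_once_from (odd i (+) s) `]bs i, bs i.+1[ q &
    changes_at_most n D q].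
Proof.
move=> g0 f0.
have /andP[b10 b1b] : 0 <= bs 1 <= b by exact: breakpoint_bounds.
have mono : monotone_on (~~ s) D1 q.
  apply: (quotient_monotone_near0 phig) => //.
  by have := phi_dir (leq0n n); rewrite bs0.
split => //; first exact: changes_in_piece.
rewrite -[n]add0n; apply: changes_total; exists (~~ s), 0%N.
by split; [exact: alternates0 | rewrite addbF eqxx].
Qed.

Lemma changes_from_general_start :
  [/\ changes_at_most 1 D1 q,
    forall i, (1 <= i <= n)%N ->
      changes_at_most_once_from (odd i (+) s) `]bs i, bs i.+1[ q &
    changes_at_most n.+1 D q].
Proof.
split; first exact: alternates_ending_at_most changes_first_piece.
  exact: changes_in_piece.
by rewrite -add1n; apply: changes_total; exact: changes_first_piece.
Qed.

End Pieces.
End QuotientTurns.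

(** * The two convexity patterns and the two kinds of start *)

Theorem theorem3 (R : realType) (b : R) (n : nat) (bs : nat -> R)
    (f g : R -> R)
    (phi := fun u => f (inverse_on b g u))
    (q := fun x => f x / g x)
    (D := quotient_domain b g)
    (D1 := D `&` [set x | x <= bs 1%N]) :
  0 < b -> (1 <= n)%N ->
  bs 0%N = 0 -> bs n.+1 = b -> (forall i, (i <= n)%N -> bs i < bs i.+1) ->
  {within `[0, b], continuous g} ->
  strictly_increasing_on `[0, b] g ->
  (forall x, x \in `]0, b] -> 0 < g x) ->
  {within `[g 0, g b], continuous phi} ->
  ((forall i, (i <= n)%N ->
      if odd i then strictly_concave_on `[g (bs i), g (bs i.+1)] phi
      else strictly_convex_on `[g (bs i), g (bs i.+1)] phi) ->
    (g 0 = 0 /\ f 0 <= 0 ->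
      [/\ strictly_increasing_on D1 q,
          forall i, (1 <= i <= n)%N ->
            changes_at_most_once_from (odd i) `]bs i, bs i.+1[ q &
          changes_at_most n D q]) /\
    ((g 0 = 0 /\ 0 < f 0) \/ 0 < g 0 ->
      [/\ changes_at_most 1 D1 q,
          forall i, (1 <= i <= n)%N ->
            changes_at_most_once_from (odd i) `]bs i, bs i.+1[ q &
          changes_at_most n.+1 D q])) /\
  ((forall i, (i <= n)%N ->
      if odd i then strictly_convex_on `[g (bs i), g (bs i.+1)] phi
      else strictly_concave_on `[g (bs i), g (bs i.+1)] phi) ->
    (g 0 = 0 /\ 0 <= f 0 ->
      [/\ strictly_decreasing_on D1 q,
          forall i, (1 <= i <= n)%N ->
            changes_at_most_once_from (~~ odd i) `]bs i, bs i.+1[ q &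
          changes_at_most n D q]) /\
    ((g 0 = 0 /\ f 0 < 0) \/ 0 < g 0 ->
      [/\ changes_at_most 1 D1 q,
          forall i, (1 <= i <= n)%N ->
            changes_at_most_once_from (~~ odd i) `]bs i, bs i.+1[ q &
          changes_at_most n.+1 D q])).
Proof.
move=> b0 n1 bs0 bsn bs_lt g_cont g_incr g_pos phi_cont.
have g_inj : {in `[0, b]%classic &, injective g}.
  move=> x y xI yI gxy.
  have [xy|yx|//] := ltgtP x y.
    by have := g_incr _ _ xI yI xy; rewrite gxy ltxx.
  by have := g_incr _ _ yI xI yx; rewrite gxy ltxx.
(* Strict monotonicity makes [g] injective on [[0, b]], so the partial inverse cancels there. *)
have phig (y : R) : 0 <= y <= b -> phi (g y) = f y.
  move=> yb; rewrite /phi /inverse_on pinvKV//.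
  by rewrite inE /= in_itv.
(* The convex start is [s = false], the concave start [s = true]. *)
split=> dir.
  have {}dir i : (i <= n)%N ->
      convex_dir (odd i (+) false) `[g (bs i), g (bs i.+1)] phi.
    by move=> /dir; rewrite addbF.
  split=> [[g0 f0]|g0].
    have g0_ge0 : 0 <= g 0 by rewrite g0.
    have [? turns ?] := changes_from_zero g_cont g_incr g_pos g0_ge0 bs0 bsn
      bs_lt phi_cont phig dir g0 f0.
    by split => // i /turns; rewrite addbF.
  have g0_ge0 : 0 <= g 0 by case: g0 => [[->]|/ltW].
  have [? turns ?] := changes_from_general_start g_cont g_incr g_pos g0_ge0 bs0 bsn
    bs_lt phi_cont phig dir.
  by split => // i /turns; rewrite addbF.
have {}dir i : (i <= n)%N ->
    convex_dir (odd i (+) true) `[g (bs i), g (bs i.+1)] phi.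
  by move=> /dir; rewrite addbT; case: (odd i).
split=> [[g0 f0]|g0].
  have g0_ge0 : 0 <= g 0 by rewrite g0.
  have [? turns ?] := changes_from_zero g_cont g_incr g_pos g0_ge0 bs0 bsn
    bs_lt phi_cont phig dir g0 f0.
  by split => // i /turns; rewrite addbT.
have g0_ge0 : 0 <= g 0 by case: g0 => [[->]|/ltW].
have [? turns ?] := changes_from_general_start g_cont g_incr g_pos g0_ge0 bs0 bsn
  bs_lt phi_cont phig dir.
by split => // i /turns; rewrite addbT.
Qed.
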